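(* Let $a,\theta\in\mathbb{R}$ with $0\le\theta\le\pi/2$, and set $\alpha=\sin(\theta)$, $\beta=\cos(\theta)$. Let $A\in\mathbb{R}^{n,n}$. Then $A$ is $\Omega_C(a,\theta)$-stable if and only if $A=(J-R)Q$ for some $J,R,Q\in\mathbb{R}^{n,n}$ such that $Q\succ 0$ and $$\begin{bmatrix}\alpha (R+aQ^{-1}) & -\beta J\\ \beta J & \alpha (R+aQ^{-1})\end{bmatrix}\succ 0.$$
   Context: $\mathbb{R}^{n,n}$ denotes the set of real $n\times n$ matrices. For a real square matrix $X$, $X\succ 0$ means that $X$ is symmetric and positive definite. The conic sector region with parameters $a$ and $\theta$ is $$\Omega_C(a,\theta)=\{x+iy\in\mathbb{C} : \sin(\theta)(x-a)<\cos(\theta)\,y<-\sin(\theta)(x-a),\ x\le a\},$$ with $x,y\in\mathbb{R}$. For a set $\Omega\subseteq\mathbb{C}$, a matrix $A\in\mathbb{R}^{n,n}$ is called $\Omega$-stable if all its eigenvalues lie in $\Omega$.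
   Formalization: For θ = π/2 the formal statement additionally requires J to be skew-symmetric (J^T = -J); without this J drops out of the block condition (β = 0) and every A, e.g. A = (a+1)I, admits such a factorization, so the claim as printed fails there. *)

(* Defs.v *)
From mathcomp Require Import all_boot all_order all_algebra.
From mathcomp Require Import classical_sets reals.
From mathcomp Require Import normedtype trigo.
From mathcomp Require Export complex.

Set Implicit Arguments.
Unset Strict Implicit.
Unset Printing Implicit Defensive.

Import Order.TTheory GRing.Theory Num.Theory.
Local Open Scope ring_scope.
Local Open Scope classical_set_scope.
Local Open Scope complex_scope.

Definition posdefmx (K : realType) (n : nat) (X : 'M[K]_n) : Prop :=
  X^T = X /\ forall v : 'cV[K]_n, v != 0 -> 0 < (v^T *m X *m v) 0 0.

Definition conic_sector (K : realType) (a theta : K) : set K[i] :=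
  [set z | [/\ sin theta * (complex.Re z - a) < cos theta * complex.Im z,
               cos theta * complex.Im z < - sin theta * (complex.Re z - a)
             & complex.Re z <= a]].

(* The eigenvalues of a real matrix are those of its complexification. *)
Definition omega_stable (K : realType) (n : nat) (Omega : set K[i])
    (A : 'M[K]_n) : Prop :=
  forall z : K[i], eigenvalue (map_mx (real_complex K) A) z -> Omega z.

(* Main.v *)
Require Import Defs.
From mathcomp Require Import all_boot all_order all_algebra.
From mathcomp Require Import classical_sets reals.
From mathcomp Require Import normedtype trigo.
From mathcomp Require Import ring lra.

Set Implicit Arguments.
Unset Strict Implicit.
Unset Printing Implicit Defensive.

Import Order.TTheory GRing.Theory Num.Theory.
Import ComplexField.Normc.
Local Open Scope ring_scope.
Local Open Scope complex_scope.

(** Write alpha = sin theta and beta = cos theta, which are nonnegative for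
    theta in [0, pi/2].  A point z lies in the sector with apex a exactly when
    h (z - a) < 0, where h w = alpha Re w + beta |Im w| is sublinear, invariant
    under conjugation and at most a multiple of the modulus ([conic_sectorE]).

    Put B = A - a, P = Q^-1 and R' = R + a P.  Then A = (J - R) Q means
    B P = J - R'; when R' is symmetric and J skew, these are determined by B P
    as its symmetric part up to sign and its skew part.  For a complex row
    u = x + i y, the number c = u B P u^* has a real part given by R' alone and
    an imaginary part given by J alone, and the quadratic form of the block
    matrix takes the values - alpha Re c + beta Im c at (x, y) and
    - alpha Re c - beta Im c at (x, -y).  So the block matrix is positive
    definite iff h is negative at u B P u^* for every nonzero u
    ([posdef_block_sector]): the numerical range of B for the inner product P
    lies in the sector with apex 0.  The theorem thus says that the spectrum of
    B lies in that sector iff, for some real inner product, the numerical range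
    of B does.

    If the numerical range does, a left eigenvector u of B for w gives
    u B P u^* = w (u P u^* ) with u P u^* > 0, hence h w < 0.  For theta = 0 the
    symmetry of R' is lost, but then the block form vanishes at (x, 0), so that
    only n = 0 is possible.

    Conversely, if the spectrum does, B is similar over the complex numbers to a
    triangular T (Schur).  Conjugating T by diag (1, d, d^2, ...) with d small
    makes the off-diagonal entries negligible, so that v T v^* is close to a
    nonnegative combination of the eigenvalues, and h is negative on it
    ([trig_scaled_cform_neg]).  Undoing the changes of basis gives a complex
    inner product S S^* ([exists_gram_cform_neg]).  As B is real and h invariant
    under conjugation, the conjugate of S S^* works too, and by sublinearity so
    does their average, which is real ([exists_posdef_cform_neg]). *)

Local Notation toC := (map_mx (real_complex _)).

(** * The sublinear function cutting out the sector *)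

Definition sector_gauge (K : realType) (al be : K) (z : K[i]) : K :=
  al * complex.Re z + be * `|complex.Im z|.

Section Gauge.
Context {K : realType} {al be : K}.
Implicit Types (z : K[i]) (t : K).

Local Notation h := (sector_gauge al be).

Lemma gauge_scale t z : 0 <= t -> h (t%:C * z) = t * h z.
Proof.
case: z => x y t0; rewrite /sector_gauge /= !mul0r subr0 addr0.
by rewrite normrM (ger0_norm t0); ring.
Qed.

Lemma gauge_conj z : h (conjc z) = h z.
Proof. by case: z => x y; rewrite /sector_gauge /= normrN. Qed.

Lemma gauge_add z1 z2 : 0 <= be -> h (z1 + z2) <= h z1 + h z2.
Proof.
case: z1 z2 => [x1 y1] [x2 y2] be0; rewrite /sector_gauge /=.
have := ler_wpM2l be0 (ler_normD y1 y2); lra.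
Qed.

Lemma gauge_sum I (r : seq I) (F : I -> K[i]) (G : I -> K) :
  0 <= be -> (forall i, h (F i) <= G i) ->
  h (\sum_(i <- r) F i) <= \sum_(i <- r) G i.
Proof.
move=> be0 FG; apply: (big_ind2 (fun z t => h z <= t)) => // [|z1 t1 z2 t2 H1 H2].
  by rewrite /sector_gauge /= normr0 !mulr0 addr0.
exact: le_trans (gauge_add _ _ be0) (lerD H1 H2).
Qed.

Lemma gauge_le_normc z : 0 <= be -> h z <= (`|al| + be) * normc z.
Proof.
case: z => x y be0; rewrite /sector_gauge /= mulrDl; apply: lerD.
  apply: le_trans (ler_norm _) _; rewrite normrM ler_wpM2l //.
  by rewrite -sqrtr_sqr ler_wsqrtr // lerDl sqr_ge0.
by rewrite ler_wpM2l // -sqrtr_sqr ler_wsqrtr // lerDr sqr_ge0.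
Qed.

End Gauge.

(** The two strict inequalities of the sector say alpha (x - a) < - beta |y|,
    which already forces x < a when alpha and beta are nonnegative. *)
Lemma conic_sectorE (K : realType) (a theta : K) (z : K[i]) :
  0 <= sin theta -> 0 <= cos theta ->
  conic_sector a theta z <-> sector_gauge (sin theta) (cos theta) (z - a%:C) < 0.
Proof.
case: z => x y s0 c0; rewrite /conic_sector /sector_gauge /= subr0.
split=> [[/= h1 h2 _]|h].
  by case: (ger0P y) => _; lra.
have h1 := ler_wpM2l c0 (ler_norm y); have h2 := ler_wpM2l c0 (ler_norm (- y)).
rewrite normrN in h2; split=> /=; try lra.
rewrite leNgt; apply/negP => ax.
have := mulr_ge0 c0 (normr_ge0 y).
have : 0 <= sin theta * (x - a) by rewrite mulr_ge0 // subr_ge0 ltW.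
lra.
Qed.

(** * Complex moduli and Hermitian forms *)

Lemma normc_ge0 (K : realType) (z : K[i]) : 0 <= normc z.
Proof. by case: z => x y; rewrite /= sqrtr_ge0. Qed.

Lemma normc_conj (K : realType) (z : K[i]) : normc (conjc z) = normc z.
Proof. by case: z => x y; rewrite /= sqrrN. Qed.

Lemma normc_real (K : realType) (t : K) : normc t%:C = `|t|.
Proof. by rewrite /= expr0n addr0 sqrtr_sqr. Qed.

Lemma mul_conjc (K : realType) (z : K[i]) : z * conjc z = (normc z ^+ 2)%:C.
Proof.
case: z => x y; rewrite /= sqr_sqrtr ?addr_ge0 ?sqr_ge0 //.
by apply/eqP; rewrite eq_complex /=; apply/andP; split; apply/eqP; ring.
Qed.

Lemma sum_normc_sqr_gt0 (K : realType) n (w : 'rV[K[i]]_n) :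
  w != 0 -> 0 < \sum_i normc (w 0 i) ^+ 2.
Proof.
move=> /rV0Pn[i wi]; rewrite lt0r sumr_ge0 => [|k _]; last exact: sqr_ge0.
rewrite andbT psumr_neq0 => [|k _]; last exact: sqr_ge0.
apply/hasP; exists i; rewrite ?mem_index_enum //=.
rewrite exprn_gt0 // lt_neqAle normc_ge0 andbT eq_sym.
by apply: contra wi => /eqP /eq0_normc ->.
Qed.

Definition adjmx (K : realType) m n (M : 'M[K[i]]_(m, n)) : 'M[K[i]]_(n, m) :=
  (map_mx conjc M)^T.

Lemma adjmxM (K : realType) m n p (M : 'M[K[i]]_(m, n)) (N : 'M[K[i]]_(n, p)) :
  adjmx (M *m N) = adjmx N *m adjmx M.
Proof. by rewrite /adjmx map_mxM trmx_mul. Qed.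

Definition cform (K : realType) n (M : 'M[K[i]]_n) (u : 'rV[K[i]]_n) : K[i] :=
  (u *m M *m adjmx u) 0 0.

Lemma cform_gram (K : realType) n (S : 'M[K[i]]_n) (u : 'rV[K[i]]_n) :
  S \in unitmx -> u != 0 -> exists2 t : K, 0 < t & cform (S *m adjmx S) u = t%:C.
Proof.
move=> Su u0; exists (\sum_i normc ((u *m S) 0 i) ^+ 2).
  apply: sum_normc_sqr_gt0; apply: contra u0 => /eqP uS0.
  by rewrite -[u](mulmxK Su) uS0 mul0mx.
rewrite /cform -!mulmxA -adjmxM mulmxA mxE rmorph_sum; apply: eq_bigr => i _.
by rewrite [adjmx _ _ _]mxE [map_mx _ _ _ _]mxE mul_conjc.
Qed.

(** * A complex inner product adapted to the spectrum *)

Lemma pos_lower_bound (K : realType) n (F : 'I_n -> K) :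
  (forall i, 0 < F i) -> exists2 m, 0 < m & forall i, m <= F i.
Proof.
move=> F0; exists (\big[Num.min/1]_i F i); last by move=> i; apply: bigmin_le_cond.
by rewrite lt_bigmin ?ltr01 //.
Qed.

(** Scaling by D = diag (d^i) multiplies the (i, j) entry of T by d^(i - j), so
    below the diagonal every entry gains a factor at most d while the diagonal
    is unchanged.  If m bounds all - h (T i i) from below and M all moduli of
    entries (times the constant c of [gauge_le_normc]) from above, summing the
    entrywise bounds gives at most (d M n - m) |w|^2. *)
Lemma trig_scaled_cform_neg (K : realType) (al be : K) n (T : 'M[K[i]]_n) :
  0 <= be -> is_trig_mx T -> (forall i, sector_gauge al be (T i i) < 0) ->
  exists D E : 'M[K[i]]_n, D *m E = 1%:M /\
   forall w : 'rV_n, w != 0 ->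
   sector_gauge al be (cform (D *m T *m E) w) < 0.
Proof.
move=> be0 /is_trig_mxP Ttrig Tneg.
have [|m m0 mP] := @pos_lower_bound K n (fun i => - sector_gauge al be (T i i)).
  by move=> i; rewrite oppr_gt0.
pose c := `|al| + be; have c0 : 0 <= c by rewrite addr_ge0.
pose M := \sum_i \sum_j c * normc (T i j).
have cT0 i j : 0 <= c * normc (T i j) by rewrite mulr_ge0 ?normc_ge0.
have M0 : 0 <= M by do 2!apply: sumr_ge0 => ? _.
have MP i j : c * normc (T i j) <= M.
  rewrite /M (bigD1 i) //= (bigD1 j) //= -addrA lerDl addr_ge0 //.
    by apply: sumr_ge0.
  by do 2!apply: sumr_ge0 => ? _.
(* This choice of d ensures both d <= 1 and d * M * n < m, also if M or n is 0. *)
pose q := m + M * n%:R; have q0 : 0 < q by rewrite ltr_wpDr // mulr_ge0 ?ler0n.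
pose d := m / q; have d0 : 0 < d by rewrite divr_gt0.
have d1 : d <= 1 by rewrite ler_pdivrMr // mul1r lerDl mulr_ge0 ?ler0n.
have dm : d * M * n%:R < m.
  rewrite (_ : _ * _ = m * (M * n%:R / q)); last by rewrite /d; ring.
  rewrite -[ltRHS]mulr1 ltr_pM2l // ltr_pdivrMr //.
  by rewrite mul1r ltrDr.
pose D := diag_mx (\row_(i < n) (d ^+ i)%:C).
pose E := diag_mx (\row_(i < n) (d ^- i)%:C).
exists D, E; split=> [|w w0].
  rewrite /D /E mulmx_diag -diag_const_mx; congr diag_mx.
  by apply/rowP => i; rewrite !mxE -rmorphM /= mulfV ?expf_neq0 ?gt_eqF.
have DTE i j : (D *m T *m E) i j = (d ^+ i / d ^+ j)%:C * T i j.
  by rewrite mul_mx_diag mul_diag_mx !mxE rmorphM /= mulrAC.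
pose a i := normc (w 0 i) ^+ 2; have a0 i : 0 <= a i by apply: sqr_ge0.
have termP i j : sector_gauge al be (w 0 j * (D *m T *m E) j i * conjc (w 0 i))
   <= (if j == i then - m * a i else 0) + d * M * ((a i + a j) / 2).
  have aa0 : 0 <= d * M * ((a i + a j) / 2).
    by rewrite mulr_ge0 ?divr_ge0 ?addr_ge0 // mulr_ge0 // ltW.
  rewrite DTE; case: (ltngtP j i) => [ji|ij|/val_inj eqji].
  - by rewrite Ttrig // !(mulr0, mul0r) -val_eqE ltn_eqF // add0r
      /sector_gauge /= normr0 !mulr0 addr0.
  - rewrite -val_eqE gtn_eqF // add0r.
    apply: le_trans (gauge_le_normc _ be0) _.
    rewrite !normcM normc_conj normc_real -/c.
    have dij : `|d ^+ j / d ^+ i| <= d.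
      rewrite ger0_norm ?divr_ge0 ?exprn_ge0 ?(ltW d0) //.
      rewrite ler_pdivrMr ?exprn_gt0 // -exprS.
      by rewrite ler_wiXn2l ?(ltW d0).
    (* The cross terms are spread over the diagonal by 2 a b <= a^2 + b^2. *)
    have amgm : normc (w 0 j) * normc (w 0 i) <= (a i + a j) / 2.
      have := sqr_ge0 (normc (w 0 j) - normc (w 0 i)); rewrite /a; nra.
    rewrite (_ : _ * _ = `|d ^+ j / d ^+ i| * (c * normc (T j i)) *
       (normc (w 0 j) * normc (w 0 i))); last by ring.
    by apply: ler_pM => //; rewrite ?mulr_ge0 ?normc_ge0 // ler_pM.
  - rewrite eqji eqxx mulfV ?expf_neq0 ?gt_eqF // mul1r mulrAC mul_conjc.
    rewrite gauge_scale ?sqr_ge0 // -/(a i).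
    have := ler_wpM2l (a0 i) (mP i); rewrite eqji in aa0; lra.
have suma : 0 < \sum_i a i by apply: sum_normc_sqr_gt0.
have -> : cform (D *m T *m E) w =
   \sum_i \sum_j w 0 j * (D *m T *m E) j i * conjc (w 0 i).
  rewrite /cform mxE; apply: eq_bigr => i _; rewrite [(w *m _) _ _]mxE mulr_suml.
  by apply: eq_bigr => j _; rewrite !mxE.
apply: le_lt_trans (gauge_sum _ be0 (fun i => gauge_sum _ be0 (termP i))) _.
rewrite (_ : \sum_i _ = (d * M * n%:R - m) * \sum_i a i).
  by rewrite nmulr_rlt0 // subr_lt0.
transitivity (\sum_i (- m * a i + d * M * ((a i *+ n + \sum_j a j) / 2))).
  apply: eq_bigr => i _; rewrite big_split /= -big_mkcond /= big_pred1_eq.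
  by rewrite -mulr_sumr -mulr_suml big_split /= sumr_const card_ord.
rewrite big_split /= -!mulr_sumr -mulr_suml big_split /= sumr_const card_ord.
rewrite sumrMnl -!(mulr_natr (\sum_i a i) n).
by move: (\sum_i a i) (d * M) => A e; field.
Qed.

(** A Lyapunov theorem, simultaneously for the two half-planes whose
    intersection is the sector h < 0: with S^-1 A S the scaled triangular form of A,
    the number u A (S S^* ) u^* is the form of S^-1 A S at w = u S. *)
Lemma exists_gram_cform_neg (K : realType) (al be : K) n (A : 'M[K[i]]_n) :
  0 <= be -> (forall z, eigenvalue A z -> sector_gauge al be z < 0) ->
  exists2 S : 'M[K[i]]_n, S \in unitmx &
   forall u : 'rV_n, u != 0 ->
   sector_gauge al be (cform (A *m (S *m adjmx S)) u) < 0.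
Proof.
case: n A => [|n] A be0 Aneg.
  by exists 1%:M => [|u]; rewrite ?unitmx1 // (thinmx0 u) eqxx.
have [U /unitarymx_unit Uu Ttrig] := @Schur _ _ A (ltn0Sn n).
rewrite /similar_to in Ttrig; set T := conjmx U A in Ttrig.
have Tneg i : sector_gauge al be (T i i) < 0.
  apply: Aneg; apply: (@eigenvalue_conjmx _ _ _ U).
  - exact: stablemx_unit.
  - by rewrite row_free_unit.
  rewrite -topredE /= eigenvalue_root_char -/T char_poly_trig //.
  rewrite -(big_map (fun i => T i i) xpredT (fun z => 'X - z%:P)).
  by rewrite root_prod_XsubC (map_f (fun i => T i i)) ?mem_index_enum.
have [D [E [DE1 DTE]]] := trig_scaled_cform_neg be0 Ttrig Tneg.
have [S defS] : exists S, S = invmx U *m E by exists (invmx U *m E).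
have DUS : D *m U *m S = 1%:M by rewrite defS mulmxA mulmxK.
have [Du Su] := mulmx1_unit DUS; exists S => // u u0.
have SDU : S *m (D *m U) = 1%:M by apply: mulmx1C.
have uSE : u *m S *m (D *m T *m E) = u *m A *m S.
  rewrite /T conjumx // -!mulmxA -defS; congr (u *m _).
  by rewrite (mulmxA D) (mulmxA S) SDU mul1mx.
have := DTE (u *m S); rewrite /cform uSE adjmxM !mulmxA; apply.
apply: contra u0 => /eqP uS0.
by rewrite -[u]mulmx1 -SDU mulmxA uS0 mul0mx.
Qed.

(** * Passing to a real inner product *)

Lemma cform_conj (K : realType) n (A : 'M[K]_n) (H : 'M[K[i]]_n) (u : 'rV[K[i]]_n) :
  cform (toC A *m map_mx conjc H) u
  = conjc (cform (toC A *m H) (map_mx conjc u)).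
Proof.
have AC : map_mx conjc (toC A) = toC A.
  by apply/matrixP=> i j; rewrite !mxE conjc_real.
rewrite /cform.
transitivity ((map_mx conjc (map_mx conjc u *m (toC A *m H) *m
   adjmx (map_mx conjc u))) 0 0); last by rewrite !mxE.
rewrite !map_mxM AC; congr ((_ *m _ *m _) 0 0).
  by apply/matrixP=> i j; rewrite !mxE /= conjcK.
by apply/matrixP=> i j; rewrite !mxE /= conjcK.
Qed.

(** Replacing H by its real part averages the forms of H and of its conjugate;
    for a real A the latter is the conjugate of a value of the former. *)
Lemma cform_re (K : realType) n (A : 'M[K]_n) (H : 'M[K[i]]_n) (u : 'rV[K[i]]_n) :
  let Ac := toC A in
  cform (toC (A *m map_mx (@complex.Re K) H)) u
  = (2^-1)%:C * (cform (Ac *m H) u + conjc (cform (Ac *m H) (map_mx conjc u))).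
Proof.
move=> Ac; rewrite -cform_conj -/Ac map_mxM.
have -> : toC (map_mx (@complex.Re K) H) =
   (2^-1)%:C *: (H + map_mx conjc H).
  apply/matrixP=> i j; rewrite !mxE ReJ_add mulrC; congr (_ * _).
  by rewrite rmorphV ?unitfE ?pnatr_eq0 // rmorph_nat.
rewrite /cform -scalemxAr mulmxDr -scalemxAr mulmxDr -scalemxAl mulmxDl.
by rewrite !mxE.
Qed.

Lemma exists_posdef_cform_neg (K : realType) (al be : K) n (A : 'M[K]_n) :
  0 <= be ->
  (forall z, eigenvalue (toC A) z -> sector_gauge al be z < 0) ->
  exists2 P : 'M[K]_n, posdefmx P &
   forall u : 'rV_n, u != 0 ->
   sector_gauge al be (cform (toC (A *m P)) u) < 0.
Proof.
move=> be0 /(exists_gram_cform_neg be0)[S Su neg].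
pose H := S *m adjmx S; exists (map_mx (@complex.Re K) H); last first.
  move=> u u0; rewrite cform_re gauge_scale ?invr_ge0 ?ler0n //.
  rewrite pmulr_rlt0 ?invr_gt0 ?ltr0n //; apply: le_lt_trans (gauge_add _ _ be0) _.
  rewrite gauge_conj -[ltRHS]addr0 ltrD // neg //.
  apply: contra u0 => /eqP u0; apply/eqP/matrixP=> i j.
  by move/matrixP/(_ i j): u0; rewrite !mxE => /(congr1 conjc); rewrite conjcK conjc0.
split=> [|v v0].
  have HH : adjmx H = H.
    rewrite /H adjmxM; congr (_ *m _).
    by apply/matrixP=> i j; rewrite !mxE conjcK.
  by apply/matrixP=> i j; rewrite -[in RHS]HH !mxE; case: (\sum_k _).
pose u := toC v^T.
have u0 : u != 0.
  apply: contra v0 => /eqP u0; apply/eqP/matrixP=> i j.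
  by move/matrixP/(_ j i): u0; rewrite !mxE => /complexI.
have uC : map_mx conjc u = u by apply/matrixP=> i j; rewrite !mxE conjc_real.
have [t t0 tE] := cform_gram Su u0.
have := cform_re 1%:M H u; rewrite /= map_mx1 !mul1mx uC tE conjc_real.
rewrite /cform [adjmx u](_ : _ = toC v); last first.
  by apply/matrixP=> i j; rewrite !mxE conjc_real.
rewrite -!map_mxM mxE -!rmorphD -rmorphM => /complexI ->.
by rewrite mulr_gt0 ?invr_gt0 ?ltr0n ?addr_gt0.
Qed.

(** * The block matrix and the numerical range *)

Lemma bilin_tr (K : realType) n (M : 'M[K]_n) (x y : 'rV[K]_n) :
  (x *m M *m y^T) 0 0 = (y *m M^T *m x^T) 0 0.
Proof.
transitivity ((x *m M *m y^T)^T 0 0); first by rewrite [RHS]mxE.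
by rewrite !trmx_mul trmxK mulmxA.
Qed.

Lemma cform_rect (K : realType) n (G : 'M[K]_n) (x y : 'rV[K]_n) :
  let b (x y : 'rV[K]_n) := (x *m G *m y^T) 0 0 in
  cform (toC G) (toC x + 'i *: toC y) = (b x x + b y y) +i* (b y x - b x y).
Proof.
move=> b.
have bE (v w : 'rV[K]_n) : (toC v *m toC G *m toC w^T) 0 0 = (b v w)%:C.
  by rewrite -!map_mxM mxE.
have -> : cform (toC G) (toC x + 'i *: toC y) =
  (b x x)%:C + 'i * (b y x)%:C - 'i * ((b x y)%:C + 'i * (b y y)%:C).
  rewrite /cform [adjmx _](_ : _ = toC x^T - 'i *: toC y^T).
    rewrite mulmxBr -scalemxAr !mulmxDl -!scalemxAl.
    rewrite -!bE !mxE; ring.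
  apply/matrixP=> i j; rewrite !mxE /=.
  by apply/eqP; rewrite eq_complex /=; apply/andP; split; apply/eqP; ring.
by apply/eqP; rewrite eq_complex /=; apply/andP; split; apply/eqP; ring.
Qed.

Lemma row_rect (K : realType) n (u : 'rV[K[i]]_n) :
  u = toC (map_mx (@complex.Re K) u) + 'i *: toC (map_mx (@complex.Im K) u).
Proof. by apply/matrixP=> k l; rewrite !mxE -complexE. Qed.

Lemma block_form (K : realType) n (al be : K) (J R : 'M[K]_n) (x y : 'rV[K]_n) :
  ((col_mx x^T y^T)^T *m block_mx (al *: R) (- (be *: J)) (be *: J) (al *: R)
    *m col_mx x^T y^T) 0 0 =
  al * ((x *m R *m x^T) 0 0 + (y *m R *m y^T) 0 0)
  + be * ((y *m J *m x^T) 0 0 - (x *m J *m y^T) 0 0).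
Proof.
rewrite tr_col_mx !trmxK mul_row_block mul_row_col !mulmxDl !mulmxN !mulNmx.
by rewrite -!scalemxAr -!scalemxAl !mxE; ring.
Qed.

(** The block form at (x, y) is alpha r - 2 beta j with r = x R x^T + y R y^T
    and j = x J y^T, while x + i y gives the value - alpha r + beta |2 j| of the
    gauge.  The absolute value corresponds to the sign change (x, -y). *)
Lemma posdef_block_sector (K : realType) n (al be : K) (J R : 'M[K]_n) :
  0 <= be -> J^T = - J -> R^T = R ->
  posdefmx (block_mx (al *: R) (- (be *: J)) (be *: J) (al *: R)) <->
  forall u : 'rV[K[i]]_n, u != 0 ->
    sector_gauge al be (cform (toC (J - R)) u) < 0.
Proof.
move=> be0 JT RT; set B := block_mx _ _ _ _.
pose r (x : 'rV[K]_n) := (x *m R *m x^T) 0 0.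
pose j (x y : 'rV[K]_n) := (x *m J *m y^T) 0 0.
have jC x y : j x y = - j y x.
  by rewrite /j bilin_tr JT mulmxN mulNmx mxE.
have RC (x y : 'rV[K]_n) : (x *m R *m y^T) 0 0 = (y *m R *m x^T) 0 0.
  by rewrite bilin_tr RT.
have jN x y : j x (- y) = - j x y by rewrite /j linearN mulmxN mxE.
have rN y : r (- y) = r y by rewrite /r linearN !mulmxN !mulNmx opprK.
have BE x y : ((col_mx x^T y^T)^T *m B *m col_mx x^T y^T) 0 0 =
    al * (r x + r y) - 2 * be * j x y.
  by rewrite block_form -/(j x y) -/(j y x) -/(r x) -/(r y) (jC y); ring.
have gE (x y : 'rV[K]_n) : sector_gauge al be (cform (toC (J - R))
   (toC x + 'i *: toC y)) =
   - (al * (r x + r y)) + be * `|2 * j x y|.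
  rewrite cform_rect /sector_gauge /= !mulmxBr !mulmxBl.
  have jxx z : j z z = 0 by have := jC z z; lra.
  have E (v w : 'rV[K]_n) : ((v *m J *m w^T - v *m R *m w^T) : 'M_1) 0 0 =
     j v w - (v *m R *m w^T) 0 0 by rewrite mxE [X in _ + X]mxE.
  rewrite !E !jxx -/(r x) -/(r y) (jC y) (RC y).
  rewrite (_ : - j x y - _ - _ = - (2 * j x y)); last by ring.
  by rewrite normrN; ring.
split=> [[_ Bpos] u u0|neg].
  pose x := map_mx (@complex.Re K) u; pose y := map_mx (@complex.Im K) u.
  have uE : u = toC x + 'i *: toC y := row_rect u.
  have col0 z : z = y \/ z = - y -> col_mx x^T z^T != 0.
    move=> zy; apply: contra u0; rewrite col_mx_eq0 !trmx_eq0 => /andP[/eqP x0 z0].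
    rewrite uE x0 (_ : y = 0) ?map_mx0 ?scaler0 ?addr0 //.
    by apply/eqP; case: zy z0 => ->; rewrite ?oppr_eq0.
  have := Bpos _ (col0 y (or_introl erefl)).
  have := Bpos _ (col0 (- y) (or_intror erefl)).
  rewrite !BE uE gE jN rN; case: (ger0P (2 * j x y)); lra.
split.
  by rewrite tr_block_mx !linearN /= !linearZ /= RT JT !scalerN !opprK.
move=> v; rewrite -[v]vsubmxK; set x := (usubmx v)^T; set y := (dsubmx v)^T.
rewrite -[usubmx v]trmxK -[dsubmx v]trmxK -/x -/y => v0.
have u0 : toC x + 'i *: toC y != 0.
  apply: contra v0 => /eqP/matrixP u0; rewrite col_mx_eq0 !trmx_eq0.
  apply/andP; split; apply/eqP/matrixP => k l; have := u0 l k;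
    by rewrite !mxE => /eqP; rewrite eq_complex /= => /andP[/eqP a0 /eqP b0]; lra.
have := neg _ u0; rewrite gE BE.
have := ler_wpM2l be0 (ler_norm (2 * j x y)); lra.
Qed.

(** * Positive definite matrices and the theorem *)

Lemma posdefmx_unit (K : realType) n (Q : 'M[K]_n) : posdefmx Q -> Q \in unitmx.
Proof.
move=> [QT Qpos]; rewrite unitmxE unitfE; apply/det0P => -[v v0 vQ].
by have := Qpos v^T; rewrite trmx_eq0 trmxK vQ mul0mx mxE ltxx => /(_ v0).
Qed.

Lemma posdefmx_inv (K : realType) n (Q : 'M[K]_n) :
  posdefmx Q -> posdefmx (invmx Q).
Proof.
move=> Qpd; have Qu := posdefmx_unit Qpd; case: Qpd => QT Qpos.
split=> [|v v0]; first by rewrite trmx_inv QT.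
have := Qpos (invmx Q *m v); rewrite trmx_mul trmx_inv QT mulmxA mulmxKV //.
apply.
by apply: contra v0 => /eqP Qv; rewrite -[v](mulKVmx Qu) Qv mulmx0.
Qed.

Lemma cform_posdef (K : realType) n (P : 'M[K]_n) (u : 'rV[K[i]]_n) :
  posdefmx P -> u != 0 ->
  exists2 t : K, 0 < t & cform (toC P) u = t%:C.
Proof.
move=> [PT Ppos] u0.
pose x := map_mx (@complex.Re K) u; pose y := map_mx (@complex.Im K) u.
have uE : u = toC x + 'i *: toC y := row_rect u.
have p0 (z : 'rV[K]_n) : 0 <= (z *m P *m z^T) 0 0.
  have [->|z0] := eqVneq z 0; first by rewrite !mul0mx mxE.
  by have := Ppos z^T; rewrite trmx_eq0 trmxK => /(_ z0) /ltW.
have p1 (z : 'rV[K]_n) : z != 0 -> 0 < (z *m P *m z^T) 0 0.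
  by move=> z0; have := Ppos z^T; rewrite trmx_eq0 trmxK => /(_ z0).
rewrite uE cform_rect (bilin_tr P y x) PT subrr; eexists; last by [].
have [x0|x0] := eqVneq x 0; last by rewrite ltr_pwDl ?p1.
rewrite ltr_wpDl ?p1 //; apply: contra u0 => /eqP y0.
by rewrite uE x0 y0 !map_mx0 scaler0 addr0.
Qed.

Lemma eigenvalue_shift (F : fieldType) n (A : 'M[F]_n) (a z : F) :
  eigenvalue (A - a%:M) z = eigenvalue A (z + a).
Proof.
apply/eigenvalueP/eigenvalueP => -[v vA v0]; exists v => //.
  by rewrite scalerDl -vA mulmxBr mul_mx_scalar subrK.
by rewrite mulmxBr vA mul_mx_scalar scalerDl addrK.
Qed.

(* For theta < pi / 2, symmetry of the block matrix forces J^T = - J.  At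
   theta = pi / 2 the blocks containing J vanish, so skew-symmetry of J has to
   be required: otherwise every A admits such a factorization. *)
Theorem theorem1 (K : realType) (n : nat) (a theta : K)
    (theta_ge0 : 0 <= theta) (theta_le : theta <= pi / 2)
    (A : 'M[K]_n) :
  let alpha := sin theta in
  let beta := cos theta in
  omega_stable (conic_sector a theta) A <->
  exists J R Q : 'M[K]_n,
    [/\ A = (J - R) *m Q,
        posdefmx Q,
        posdefmx (block_mx (alpha *: (R + a *: invmx Q)) (- (beta *: J))
                           (beta *: J) (alpha *: (R + a *: invmx Q)))
      & theta = pi / 2 -> J^T = - J].
Proof.
move=> al be.
have pi0 := pi_gt0 K.
have al0 : 0 <= al by apply: sin_ge0_pi; lra.
have be0 : 0 <= be by apply: cos_ge0_pihalf; lra.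
pose B := A - a%:M.
have BC : toC B = toC A - (a%:C)%:M.
  by rewrite map_mxB map_scalar_mx.
split=> [stab|[J [R [Q [AE Qpd Bpd JT]]]]].
  have neg z : eigenvalue (toC B) z -> sector_gauge al be z < 0.
    rewrite BC eigenvalue_shift => /stab /(conic_sectorE _ _ al0 be0).
    by rewrite addrK.
  have [P Ppd Pneg] := exists_posdef_cform_neg be0 neg.
  have Pu := posdefmx_unit Ppd; have [PT _] := Ppd.
  (* B P is split into its skew part J and its symmetric part - R'. *)
  pose J := 2^-1 *: (B *m P - (B *m P)^T).
  pose R' := - (2^-1 *: (B *m P + (B *m P)^T)).
  have BPE : B *m P = J - R'.
    rewrite opprK -scalerDr addrACA addNr addr0 -mulr2n -scaler_nat scalerA.
    by rewrite mulVf ?scale1r ?pnatr_eq0.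
  have JT : J^T = - J by rewrite /J linearZ linearB /= trmxK -scalerN opprB.
  have RT : R'^T = R' by rewrite /R' linearN linearZ linearD /= trmxK addrC.
  exists J, (R' - a *: P), (invmx P); split=> //.
  - rewrite opprB addrA addrAC -BPE mulmxDl mulmxK // -scalemxAl mulmxV //.
    by rewrite scalemx1 subrK.
  - exact: posdefmx_inv.
  rewrite invmxK subrK; apply/posdef_block_sector => // u u0.
  by rewrite -BPE Pneg.
have Qu := posdefmx_unit Qpd; have Ppd := posdefmx_inv Qpd.
set P := invmx Q in Ppd Bpd.
have BPE : B *m P = J - (R + a *: P).
  by rewrite /B AE mulmxBl mulmxK // mul_scalar_mx opprD addrA.
have [BT Bpos] := Bpd.
move: BT; rewrite tr_block_mx => /eq_block_mx[RT JT' _ _].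
move=> z /eigenvalueP[u uA u0].
(* If alpha = 0, the block form is 0 at (x, 0) for every x. *)
have al_gt0 : 0 < al.
  rewrite lt_neqAle al0 andbT eq_sym; apply/eqP => al_eq0.
  have /rV0Pn[i _] := u0.
  pose x : 'rV[K]_n := delta_mx 0 i.
  have : col_mx x^T (0 : 'rV[K]_n)^T != 0.
    rewrite col_mx_eq0 !trmx_eq0 negb_and; apply/orP; left.
    by apply/rV0Pn; exists i; rewrite mxE !eqxx oner_eq0.
  move/Bpos; rewrite block_form al_eq0 mul0r add0r trmx0 !mul0mx mulmx0 mxE.
  by rewrite subrr mulr0 ltxx.
have skew : J^T = - J.
  have [be_eq0|be_neq0] := eqVneq be 0; last first.
    by move: JT'; rewrite linearZ /= -scalerN => /(scalerI be_neq0).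
  apply: JT; apply/eqP; rewrite eq_le theta_le /= leNgt; apply/negP => th.
  suff : 0 < be by rewrite be_eq0 ltxx.
  by apply: cos_gt0_pihalf; rewrite th andbT; lra.
have sym : (R + a *: P)^T = R + a *: P.
  by move: RT; rewrite linearZ /= => /(scalerI (lt0r_neq0 al_gt0)).
have := (posdef_block_sector al be0 skew sym).1 Bpd u u0.
rewrite -BPE => neg; apply/(conic_sectorE _ _ al0 be0).
have [t t0 tE] := cform_posdef Ppd u0.
move: neg; rewrite map_mxM /cform mulmxA BC mulmxBr uA mul_mx_scalar -scalerBl.
rewrite -!scalemxAl mxE -/(cform _ _) tE mulrC gauge_scale ?(ltW t0) //.
by rewrite pmulr_rlt0.
Qed.
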